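(* Let $\mathcal{G}$ be the category of finite graphs and graph maps. There does not exist a Strøm–Hurewicz type model structure on $\mathcal{G}$; that is, there is no model structure on $\mathcal{G}$ in which the weak equivalences are the $\times$-homotopy equivalences, the cofibrations have the $\times$-homotopy extension property, and the fibrations have the $\times$-homotopy lifting property.
   Context: A graph $G$ is a pair $(V(G),E(G))$ where $E(G)$ is a set of unordered pairs $\{x,y\}$ (written $xy$) of vertices, with $x=y$ allowed (a loop); there are no multiple edges. All graphs are finite. A graph map $f:G\to H$ is a function $V(G)\to V(H)$ such that $xy\in E(G)$ implies $f(x)f(y)\in E(H)$. $\mathcal{G}$ is the category of finite graphs and graph maps. The product $G\times H$ has vertex set $V(G)\times V(H)$, and $(g,h)(g',h')\in E(G\times H)$ iff $gg'\in E(G)$ and $hh'\in E(H)$. For $n\in\mathbb{N}$, $I_n$ is the graph with vertex set $\{0,1,\dots,n\}$ and edges $ij$ for $|i-j|\le 1$ (so every vertex is looped). Two graph maps $f,g:A\to B$ are $\times$-homotopic, $f\simeq_\times g$, if for some $n\in\mathbb{N}$ there is a graph map $F:A\times I_n\to B$ with $F(a,0)=f(a)$ and $F(a,n)=g(a)$ for all $a\in V(A)$. A graph map $f:A\to B$ is a $\times$-homotopy equivalence if there is a graph map $g:B\to A$ with $gf\simeq_\times 1_A$ and $fg\simeq_\times 1_B$. A graph map $i:A\to B$ has the $\times$-homotopy extension property if for every $n\in\mathbb{N}$, every finite graph $Z$ and all graph maps $g:B\to Z$ and $F:A\times I_n\to Z$ with $F(a,0)=g(i(a))$ for all $a\in V(A)$,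 there is a graph map $G:B\times I_n\to Z$ with $G\circ(i\times 1_{I_n})=F$ and $G(b,0)=g(b)$ for all $b\in V(B)$. A graph map $p:X\to Y$ has the $\times$-homotopy lifting property if for every $n\in\mathbb{N}$, every finite graph $A$ and all graph maps $f:A\to X$ and $g:A\times I_n\to Y$ with $p(f(a))=g(a,0)$ for all $a\in V(A)$, there is a graph map $G:A\times I_n\to X$ with $G(a,0)=f(a)$ for all $a\in V(A)$ and $pG=g$. A model structure on a category is a choice of three classes of morphisms (cofibrations, fibrations, weak equivalences) such that: (1) all finite limits and finite colimits exist; (2) each of the three classes is closed under retracts (of morphisms); (3) if $gf$ is defined and two of $f,g,gf$ are weak equivalences, so is the third; (4) acyclic cofibrations (cofibrations that are weak equivalences) have the left lifting property with respect to fibrations, and cofibrations have the left lifting property with respect to acyclic fibrations (fibrations that are weak equivalences); (5) every morphism factors as a cofibration followed by an acyclic fibration, and as an acyclic cofibration followed by a fibration. *)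

(* Defs.v *)
From HB Require Import structures.
From mathcomp Require Import all_boot.

Set Implicit Arguments.
Unset Strict Implicit.
Unset Printing Implicit Defensive.

Declare Scope cat_scope.
Delimit Scope cat_scope with cat.

Record category := Category {
  Ob :> Type;
  Hom : Ob -> Ob -> Type;
  idm : forall A, Hom A A;
  comp : forall A B C, Hom B C -> Hom A B -> Hom A C;
  comp_idl : forall A B (f : Hom A B), comp (idm B) f = f;
  comp_idr : forall A B (f : Hom A B), comp f (idm A) = f;
  comp_assoc : forall A B C D (h : Hom C D) (g : Hom B C) (f : Hom A B),
    comp h (comp g f) = comp (comp h g) f
}.
Arguments Hom {c} A B.
Arguments idm {c} A.
Arguments comp {c A B C} g f.

Notation "g \o f" := (comp g f) : cat_scope.
Local Open Scope cat_scope.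

Record functor (J C : category) := Functor {
  fob :> J -> C;
  fmap : forall i j : J, Hom i j -> Hom (fob i) (fob j);
  fmap_id : forall i : J, fmap (idm i) = idm (fob i);
  fmap_comp : forall (i j k : J) (v : Hom j k) (u : Hom i j),
    fmap (v \o u) = fmap v \o fmap u
}.
Arguments fmap {J C} f {i j} u.

Definition finite_type (T : Type) : Prop :=
  exists (F : finType) (e : F -> T), bijective e.

Definition finite_category (J : category) : Prop :=
  finite_type J /\ forall i j : J, finite_type (Hom i j).

Section Limits.
Variables (J C : category) (D : functor J C).

Definition is_cone (L : C) (p : forall j : J, Hom L (D j)) : Prop :=
  forall (i j : J) (u : Hom i j), fmap D u \o p i = p j.

Definition is_limit (L : C) (p : forall j : J, Hom L (D j)) : Prop :=
  is_cone p /\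
  forall (X : C) (q : forall j : J, Hom X (D j)), is_cone q ->
    exists! h : Hom X L, forall j : J, p j \o h = q j.

Definition is_cocone (L : C) (p : forall j : J, Hom (D j) L) : Prop :=
  forall (i j : J) (u : Hom i j), p j \o fmap D u = p i.

Definition is_colimit (L : C) (p : forall j : J, Hom (D j) L) : Prop :=
  is_cocone p /\
  forall (X : C) (q : forall j : J, Hom (D j) X), is_cocone q ->
    exists! h : Hom L X, forall j : J, h \o p j = q j.

End Limits.

Definition has_finite_limits (C : category) : Prop :=
  forall (J : category) (D : functor J C), finite_category J ->
    exists (L : C) (p : forall j : J, Hom L (D j)), is_limit p.

Definition has_finite_colimits (C : category) : Prop :=
  forall (J : category) (D : functor J C), finite_category J ->
    exists (L : C) (p : forall j : J, Hom (D j) L), is_colimit p.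

Definition morphism_class (C : category) := forall A B : C, Hom A B -> Prop.

Section ModelStructure.
Variable C : category.

Definition is_retract (A B X Y : C) (f : Hom A B) (g : Hom X Y) : Prop :=
  exists (i : Hom A X) (r : Hom X A) (j : Hom B Y) (s : Hom Y B),
    [/\ r \o i = idm A, s \o j = idm B, g \o i = j \o f & f \o r = s \o g].

Definition closed_under_retracts (P : morphism_class C) : Prop :=
  forall (A B X Y : C) (f : Hom A B) (g : Hom X Y),
    is_retract f g -> P X Y g -> P A B f.

Definition two_out_of_three (P : morphism_class C) : Prop :=
  forall (X Y Z : C) (f : Hom X Y) (g : Hom Y Z),
    [/\ P X Y f -> P Y Z g -> P X Z (g \o f),
        P X Y f -> P X Z (g \o f) -> P Y Z g &
        P Y Z g -> P X Z (g \o f) -> P X Y f].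

(* i has the left lifting property with respect to p *)
Definition llp (A B X Y : C) (i : Hom A B) (p : Hom X Y) : Prop :=
  forall (f : Hom A X) (g : Hom B Y), p \o f = g \o i ->
    exists h : Hom B X, h \o i = f /\ p \o h = g.

Definition class_llp (P Q : morphism_class C) : Prop :=
  forall (A B X Y : C) (i : Hom A B) (p : Hom X Y),
    P A B i -> Q X Y p -> llp i p.

Definition factors_as (P Q : morphism_class C) : Prop :=
  forall (X Y : C) (f : Hom X Y),
    exists (Z : C) (i : Hom X Z) (p : Hom Z Y),
      [/\ P X Z i, Q Z Y p & f = p \o i].

Definition class_cap (P Q : morphism_class C) : morphism_class C :=
  fun A B f => P A B f /\ Q A B f.

Record model_structure := ModelStructure {
  cofibration : morphism_class C;
  fibration : morphism_class C;
  weak_equivalence : morphism_class C;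
  ms_limits : has_finite_limits C;
  ms_colimits : has_finite_colimits C;
  ms_retract_cof : closed_under_retracts cofibration;
  ms_retract_fib : closed_under_retracts fibration;
  ms_retract_weq : closed_under_retracts weak_equivalence;
  ms_two_out_of_three : two_out_of_three weak_equivalence;
  ms_lift_acyclic_cof :
    class_llp (class_cap cofibration weak_equivalence) fibration;
  ms_lift_acyclic_fib :
    class_llp cofibration (class_cap fibration weak_equivalence);
  ms_factor_acyclic_fib :
    factors_as cofibration (class_cap fibration weak_equivalence);
  ms_factor_acyclic_cof :
    factors_as (class_cap cofibration weak_equivalence) fibration
}.

End ModelStructure.
Arguments cofibration {C} m {A B} f.
Arguments fibration {C} m {A B} f.
Arguments weak_equivalence {C} m {A B} f.

(* The edge set is encoded as a symmetric relation; [edge x x] means that x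
   carries a loop. *)
Record graph := Graph {
  vert :> finType;
  edge : rel vert;
  edge_sym : symmetric edge
}.
Arguments edge {g} x y.

(* Finite functions and a boolean edge condition make Leibniz equality of graph
   maps coincide with pointwise equality. *)
Record graph_map (A B : graph) := GraphMap {
  gfun :> {ffun A -> B};
  gfun_edgeb : [forall x, forall y, edge x y ==> edge (gfun x) (gfun y)]
}.

HB.instance Definition _ (A B : graph) := [isSub for @gfun A B].

Lemma gfun_edge (A B : graph) (f : graph_map A B) (x y : A) :
  edge x y -> edge (f x) (f y).
Proof. by have /forallP/(_ x)/forallP/(_ y)/implyP := gfun_edgeb f. Qed.

Lemma mk_graph_map_proof (A B : graph) (f : A -> B) :
  (forall x y, edge x y -> edge (f x) (f y)) ->
  [forall x, forall y, edge x y ==> edge ([ffun x => f x] x) ([ffun x => f x] y)].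
Proof.
by move=> fP; apply/forallP=> x; apply/forallP=> y; rewrite !ffunE; apply/implyP/fP.
Qed.

Definition mk_graph_map (A B : graph) (f : A -> B)
    (fP : forall x y, edge x y -> edge (f x) (f y)) : graph_map A B :=
  GraphMap (mk_graph_map_proof fP).

Lemma mk_graph_mapE (A B : graph) (f : A -> B) fP (x : A) :
  @mk_graph_map A B f fP x = f x.
Proof. by rewrite ffunE. Qed.

Lemma graph_mapP (A B : graph) (f g : graph_map A B) :
  (forall x, f x = g x) <-> f = g.
Proof. by split=> [fg|-> //]; apply/val_inj/ffunP. Qed.

Definition graph_id (A : graph) : graph_map A A :=
  @mk_graph_map A A id (fun _ _ => id).

Definition graph_comp (A B C : graph) (g : graph_map B C) (f : graph_map A B) :
    graph_map A C :=
  @mk_graph_map A C (fun x => g (f x))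
    (fun _ _ xy => gfun_edge g (gfun_edge f xy)).

Lemma graph_comp_idl (A B : graph) (f : graph_map A B) :
  graph_comp (graph_id B) f = f.
Proof. by apply/graph_mapP=> x; rewrite !mk_graph_mapE. Qed.

Lemma graph_comp_idr (A B : graph) (f : graph_map A B) :
  graph_comp f (graph_id A) = f.
Proof. by apply/graph_mapP=> x; rewrite !mk_graph_mapE. Qed.

Lemma graph_comp_assoc (A B C D : graph) (h : graph_map C D)
    (g : graph_map B C) (f : graph_map A B) :
  graph_comp h (graph_comp g f) = graph_comp (graph_comp h g) f.
Proof. by apply/graph_mapP=> x; rewrite !mk_graph_mapE. Qed.

Definition graph_category : category :=
  Category graph_comp_idl graph_comp_idr graph_comp_assoc.

Section GraphProduct.
Variables G H : graph.

Definition prod_edge : rel (G * H)%type :=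
  fun u v => edge u.1 v.1 && edge u.2 v.2.

Lemma prod_edge_sym : symmetric prod_edge.
Proof.
by move=> u v; rewrite /prod_edge (edge_sym u.1) (edge_sym u.2).
Qed.

Definition graph_prod : graph := Graph prod_edge_sym.

End GraphProduct.

Section GraphProductMap.
Variables (A B C D : graph) (f : graph_map A B) (g : graph_map C D).

Definition prod_fun (u : graph_prod A C) : graph_prod B D := (f u.1, g u.2).

Lemma prod_fun_edge (u v : graph_prod A C) :
  edge u v -> edge (prod_fun u) (prod_fun v).
Proof.
by case/andP=> uv1 uv2; apply/andP; split; apply: gfun_edge.
Qed.

Definition graph_prod_map : graph_map (graph_prod A C) (graph_prod B D) :=
  mk_graph_map prod_fun_edge.

End GraphProductMap.

Section Interval.
Variable n : nat.

Definition interval_edge : rel 'I_n.+1 := fun i j => (i <= j.+1) && (j <= i.+1).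

Lemma interval_edge_sym : symmetric interval_edge.
Proof. by move=> i j; rewrite /interval_edge andbC. Qed.

Definition interval_graph : graph := Graph interval_edge_sym.

End Interval.

Definition times_homotopic (A B : graph) (f g : graph_map A B) : Prop :=
  exists (n : nat) (F : graph_map (graph_prod A (interval_graph n)) B),
    (forall a : A, F (a, ord0) = f a) /\ (forall a : A, F (a, ord_max) = g a).

Definition times_homotopy_equivalence (A B : graph) (f : graph_map A B) : Prop :=
  exists g : graph_map B A,
    times_homotopic (graph_comp g f) (graph_id A) /\
    times_homotopic (graph_comp f g) (graph_id B).

Definition times_HEP (A B : graph) (i : graph_map A B) : Prop :=
  forall (n : nat) (Z : graph) (g : graph_map B Z)
         (F : graph_map (graph_prod A (interval_graph n)) Z),
    (forall a : A, F (a, ord0) = g (i a)) ->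
    exists G : graph_map (graph_prod B (interval_graph n)) Z,
      graph_comp G (graph_prod_map i (graph_id (interval_graph n))) = F /\
      (forall b : B, G (b, ord0) = g b).

Definition times_HLP (X Y : graph) (p : graph_map X Y) : Prop :=
  forall (n : nat) (A : graph) (f : graph_map A X)
         (g : graph_map (graph_prod A (interval_graph n)) Y),
    (forall a : A, p (f a) = g (a, ord0)) ->
    exists G : graph_map (graph_prod A (interval_graph n)) X,
      (forall a : A, G (a, ord0) = f a) /\ graph_comp p G = g.

Definition Strom_Hurewicz_type (M : model_structure graph_category) : Prop :=
  [/\ forall (A B : graph) (f : graph_map A B),
        weak_equivalence (C := graph_category) M f <-> times_homotopy_equivalence f,
      forall (A B : graph) (f : graph_map A B),
        cofibration (C := graph_category) M f -> times_HEP f &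
      forall (A B : graph) (f : graph_map A B),
        fibration (C := graph_category) M f -> times_HLP f].

(* Main.v *)
Require Import Defs.
From HB Require Import structures.
From mathcomp Require Import all_boot.

Set Implicit Arguments.
Unset Strict Implicit.
Unset Printing Implicit Defensive.

(** A map [i : A -> B] with the homotopy extension property, tested against its
    own mapping cylinder, has an image closed under adjacency: a neighbour [b] of
    [i a] must be adjacent to the vertex [(a, 1)] of the cylinder, whose only
    neighbours in [B] lie in the image of [i].  A map with the homotopy lifting
    property, on the other hand, lifts looped neighbours of [p x] to neighbours
    of [x], for [x] looped.  Hence the inclusion of an endpoint into [I_1] does
    not factor as a map of the first kind followed by one of the second kind: the
    lift of the other endpoint would be a neighbour of the image of [i], and so in
    that image. *)

Section MappingCylinder.
Variables (A B : graph) (i : graph_map A B).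

(* Only the length-one cylinder: [inr a] is the vertex [(a, 1)] of [A * I_1],
   while [(a, 0)] is identified with [inl (i a)]. *)
Definition cylinder_edge : rel (B + A)%type := fun u v =>
  match u, v with
  | inl b, inl b' => edge b b'
  | inr a, inr a' => edge a a'
  | inl b, inr a | inr a, inl b => [exists a', (i a' == b) && edge a' a]
  end.

Lemma cylinder_edge_sym : symmetric cylinder_edge.
Proof. by case=> [b|a] [b'|a'] //=; apply: edge_sym. Qed.

Definition cylinder_graph : graph := Graph cylinder_edge_sym.

Definition cylinder_base : graph_map B cylinder_graph :=
  @mk_graph_map B cylinder_graph inl (fun _ _ bb' => bb').

Definition cylinder_fun (u : graph_prod A (interval_graph 1)) : cylinder_graph :=
  if u.2 == ord0 then inl (i u.1) else inr u.1.

Lemma cylinder_fun_edge (u v : graph_prod A (interval_graph 1)) :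
  edge u v -> edge (cylinder_fun u) (cylinder_fun v).
Proof.
case: u v => [a s] [a' t] /andP[/= aa' _]; rewrite /cylinder_fun /=.
case: ifP => _; case: ifP => _ //=; first exact: gfun_edge.
- by apply/existsP; exists a; rewrite eqxx.
- by apply/existsP; exists a'; rewrite eqxx edge_sym.
Qed.

Definition cylinder_map : graph_map (graph_prod A (interval_graph 1)) cylinder_graph :=
  mk_graph_map cylinder_fun_edge.

End MappingCylinder.

Lemma times_HEP_image_closed (A B : graph) (i : graph_map A B) (a : A) (b : B) :
  times_HEP i -> edge (i a) b -> exists a', i a' = b.
Proof.
move=> hep iab.
have F0 x : cylinder_map i (x, ord0) = cylinder_base i (i x).
  by rewrite !mk_graph_mapE.
have [G [GF Gg]] := hep 1 _ _ _ F0.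
have G1 : G (i a, ord_max) = inr a.
  move/graph_mapP/(_ (a, ord_max)): GF.
  by rewrite !mk_graph_mapE /prod_fun /= ffunE.
(* Times 0 and 1 are adjacent in [I_1], so [(b, 0)] and [(i a, 1)] are adjacent in [B * I_1]; [G]
   sends them to [inl b] and [inr a]. *)
have : edge (G (b, ord0)) (G (i a, ord_max)).
  by apply: gfun_edge; rewrite /= /prod_edge /= edge_sym iab.
by rewrite Gg G1 mk_graph_mapE => /existsP[a' /andP[/eqP <- _]]; exists a'.
Qed.

Lemma times_HLP_lift_neighbour (X Y : graph) (p : graph_map X Y) (x : X) (y : Y) :
  times_HLP p -> edge x x -> edge y y -> edge (p x) y ->
  exists2 x', edge x x' & p x' = y.
Proof.
move=> hlp xx yy pxy.
(* A homotopy of maps out of the looped point [interval_graph 0] is a walk through looped vertices;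
   [h] is the walk from [p x] to [y]. *)
pose f : graph_map (interval_graph 0) X :=
  @mk_graph_map (interval_graph 0) X (fun=> x) (fun _ _ _ => xx).
pose h (u : graph_prod (interval_graph 0) (interval_graph 1)) : Y :=
  if u.2 == ord0 then p x else y.
have hE u v : edge u v -> edge (h u) (h v).
  move=> _; rewrite /h; case: ifP => _; case: ifP => _ //.
  - exact: gfun_edge.
  - by rewrite edge_sym.
have f0 c : p (f c) = mk_graph_map hE (c, ord0) by rewrite !mk_graph_mapE.
have [G [G0 pG]] := hlp 1 _ _ _ f0.
exists (G (ord0, ord_max)).
  have -> : x = G (ord0, ord0) by rewrite G0 mk_graph_mapE.
  by apply: gfun_edge.
by move/graph_mapP/(_ (ord0, ord_max)): pG; rewrite !mk_graph_mapE.
Qed.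

Theorem theorem2p11 :
  ~ (exists M : model_structure graph_category, Strom_Hurewicz_type M).
Proof.
case=> M [_ cofP fibP].
pose f : graph_map (interval_graph 0) (interval_graph 1) :=
  @mk_graph_map (interval_graph 0) (interval_graph 1) (fun=> ord0)
    (fun _ _ _ => isT).
have [Z [i [p [[cof_i _] fib_p fE]]]] := ms_factor_acyclic_cof M f.
have piE c : p (i c) = ord0.
  by move/graph_mapP/(_ c): fE; rewrite !mk_graph_mapE.
have [|||z iz pz] := @times_HLP_lift_neighbour _ (interval_graph 1) p (i ord0)
  ord_max (fibP _ _ _ fib_p).
- exact: gfun_edge.
- by [].
- by rewrite piE.
(* The vertex [z] lies over [ord_max], but the image of [i] lies over [ord0]. *)
have [c ic] := times_HEP_image_closed (cofP _ _ _ cof_i) iz.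
by move: pz; rewrite -ic piE.
Qed.
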